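(* There exists a first order convergent sequence of finite binary matroids (matroids representable over $\mathbb{F}_2$) that has no limit matroid modeling.
   Context: Language: $\lambda_M$ contains a $k$-ary relation symbol $I_k$ for each $k\ge1$; a matroid is a $\lambda_M$-structure where $I_k(x_1,\dots,x_k)$ holds iff $x_1,\dots,x_k$ form an independent set of size $k$. A $\lambda$-modeling is a $\lambda$-structure on a standard Borel space with probability measure $\nu$ such that all first-order definable sets $A^\varphi\subseteq A^k$ are $\nu^k$-measurable; Stone pairing $\langle\varphi,A\rangle=\nu^k(A^\varphi)$ (uniform measure for finite structures). A sequence of finite matroids is first order convergent if $\langle\varphi,M_n\rangle$ converges for every first order $\lambda_M$-formula $\varphi$. A limit matroid modeling of the sequence is a $\lambda_M$-modeling that is an infinite matroid (in the sense of Bruhn et al., defined via circuit axioms (C1), (C2), (C3'), (CM)) with $\langle\varphi,\mathbf{M}\rangle=\lim_n\langle\varphi,M_n\rangle$ for every first order $\lambda_M$-formula $\varphi$. *)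

(* Defs.v *)
From HB Require Import structures.
From mathcomp Require Import all_boot all_order all_algebra.
From mathcomp Require Import all_classical all_reals all_analysis.

Set Implicit Arguments.
Unset Strict Implicit.
Unset Printing Implicit Defensive.

Import Order.TTheory GRing.Theory Num.Theory.
Import numFieldNormedType.Exports.
Local Open Scope classical_set_scope.
Local Open Scope ring_scope.

(* The language lambda_M: a k-ary relation symbol I_k for each k >= 1. *)
(* We write [FRel k v] for the atomic formula I_(k+1)(x_(v 0),...,      *)
(* x_(v k)); variables are natural numbers.  First-order logic with     *)
Inductive formula : Type :=
| FRel (k : nat) (v : 'I_k.+1 -> nat)
| FEq (i j : nat)
| FNeg (f : formula)
| FAnd (f g : formula)
| FEx (i : nat) (f : formula).

Definition lstructure (T : Type) := forall k : nat, ('I_k.+1 -> T) -> Prop.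

Fixpoint sat (T : Type) (I : lstructure T) (a : nat -> T) (f : formula)
  : Prop :=
  match f with
  | FRel k v => I k (fun i => a (v i))
  | FEq i j => a i = a j
  | FNeg g => ~ sat I a g
  | FAnd g h => sat I a g /\ sat I a h
  | FEx i g => exists x : T, sat I (fun n => if n == i then x else a n) g
  end.

Fixpoint fv (f : formula) : seq nat :=
  match f with
  | FRel k v => [seq v i | i <- enum 'I_k.+1]
  | FEq i j => [:: i; j]
  | FNeg g => fv g
  | FAnd g h => fv g ++ fv h
  | FEx i g => [seq n <- fv g | n != i]
  end.

Definition fv_below (f : formula) (k : nat) : bool :=
  all (fun n => (n < k)%N) (fv f).

(* the definable set A^f \subseteq A^k (for f with fv_below f k) *)
Definition dset (T : Type) (I : lstructure T) (k : nat) (f : formula)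
  : set (k.-tuple T) :=
  [set x | forall a : nat -> T, (forall i : 'I_k, a i = tnth x i) -> sat I a f].

Arguments dset {T} I k f _.

Definition fin_matroid (E : finType) (indep : {set E} -> bool) : Prop :=
  [/\ indep (@finset.set0 E),
      (forall A B : {set E}, indep B -> A \subset B -> indep A) &
      (forall A B : {set E}, indep A -> indep B -> (#|A| < #|B|)%N ->
         exists2 x, x \in B :\: A & indep (x |: A))].

Definition binary (E : finType) (indep : {set E} -> bool) : Prop :=
  exists (n : nat) (phi : E -> 'rV['F_2]_n),
    forall S : {set E}, indep S = free [seq phi x | x <- enum S].

Definition fin_mstruct (E : finType) (indep : {set E} -> bool)
  : lstructure E :=
  fun k x => injective x /\ indep [set x i | i : 'I_k.+1].

Arguments fin_mstruct {E} indep k x.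

Definition stone_fin (R : realType) (E : finType) (I : lstructure E)
  (k : nat) (f : formula) : R :=
  (#|[set x : k.-tuple E | `[< dset I k f x >]]|%:R / (#|E| ^ k)%:R).

Definition FO_convergent (R : realType) (E : nat -> finType)
  (indep : forall n, {set E n} -> bool) : Prop :=
  forall (k : nat) (f : formula), fv_below f k ->
    cvgn (fun n => stone_fin R (fin_mstruct (indep n)) k f).

Arguments FO_convergent R E indep : clear implicits.

(* Infinite matroids (Bruhn et al.), circuit axioms, ground set = T.   *)
Definition inf_indep (T : Type) (C : set (set T)) (S : set T) : Prop :=
  forall D, C D -> ~ (D `<=` S).

Definition inf_matroid_circuits (T : Type) (C : set (set T)) : Prop :=
  [/\ (* (C1) *) ~ C set0,
      (* (C2) *) (forall D1 D2, C D1 -> C D2 -> D1 `<=` D2 -> D1 = D2),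
      (forall (X D : set T) (Cx : T -> set T),
         C D -> X `<=` D -> (forall x, X x -> C (Cx x)) ->
         (forall x y, X x -> X y -> (Cx y x <-> x = y)) ->
         forall z, D z -> ~ (\bigcup_(x in X) Cx x) z ->
         exists D', [/\ C D', D' z &
                        D' `<=` (D `|` \bigcup_(x in X) Cx x) `\` X]) &
      (forall I X : set T, inf_indep C I -> I `<=` X ->
         exists M, [/\ inf_indep C M, I `<=` M, M `<=` X &
           forall M', inf_indep C M' -> M `<=` M' -> M' `<=` X -> M' = M])].

Definition is_matroid_struct (T : Type) (I : lstructure T) : Prop :=
  exists C : set (set T), inf_matroid_circuits C /\
    forall k (x : 'I_k.+1 -> T), I k x <-> (injective x /\ inf_indep C (range x)).

Definition standard_borel (R : realType) (d : measure_display)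
  (T : measurableType d) : Prop :=
  exists (g : T -> R) (B : set R),
    [/\ measurable B, g @` setT = B, injective g, measurable_fun setT g &
        forall A : set T, measurable A -> measurable (g @` A)].

(* mu is the k-fold product measure nu^k on (k.-tuple T) with its product
   sigma-algebra (rectangles determine it uniquely) *)
Definition is_product_measures (R : realType) (d : measure_display)
  (T : measurableType d) (nu : {measure set T -> \bar R})
  (mu : forall k : nat, {measure set (k.-tuple T) -> \bar R}) : Prop :=
  forall (k : nat) (A : 'I_k -> set T), (forall i, measurable (A i)) ->
    mu k [set x | forall i, A i (tnth x i)] = (\prod_(i < k) nu (A i))%E.

(* S is mu-measurable (in the completion) with measure m *)
Definition cmeasure (R : realType) (d : measure_display)
  (T : measurableType d) (mu : {measure set T -> \bar R}) (S : set T)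
  (m : \bar R) : Prop :=
  exists B N : set T, [/\ measurable B, measurable N, mu N = 0%E,
    (S `\` B) `|` (B `\` S) `<=` N & mu B = m].

Definition is_modeling (R : realType) (d : measure_display)
  (T : measurableType d) (I : lstructure T) (nu : {measure set T -> \bar R})
  (mu : forall k : nat, {measure set (k.-tuple T) -> \bar R}) : Prop :=
  [/\ standard_borel R T, nu setT = 1%E, is_product_measures nu mu &
      forall k f, fv_below f k -> exists m, cmeasure (mu k) (dset I k f) m].

Definition has_limit_matroid_modeling (R : realType) (E : nat -> finType)
  (indep : forall n, {set E n} -> bool) : Prop :=
  exists (d : measure_display) (T : measurableType d) (I : lstructure T)
         (nu : {measure set T -> \bar R})
         (mu : forall k : nat, {measure set (k.-tuple T) -> \bar R}),
    [/\ is_modeling I nu mu, is_matroid_struct I &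
      forall k f, fv_below f k -> exists m : \bar R,
        cmeasure (mu k) (dset I k f) m /\
        (fun n => stone_fin R (fin_mstruct (indep n)) k f) @ \oo --> fine m].

Arguments has_limit_matroid_modeling R E indep : clear implicits.

(* Main.v *)
Require Import Defs.
From HB Require Import structures.
From mathcomp Require Import all_boot all_order all_algebra.
From mathcomp Require Import all_classical all_reals all_analysis.
From mathcomp Require Import measurable_realfun ring lra.
Set Implicit Arguments.
Unset Strict Implicit.
Unset Printing Implicit Defensive.

Import Order.TTheory GRing.Theory Num.Theory.
Import numFieldNormedType.Exports.
Local Open Scope classical_set_scope.
Local Open Scope ring_scope.

(* Let M_n be the binary matroid on the points (a, b, 1 + a.b) of a quadric over
   F_2, with a, b in F_2^n. Two points x, y have their sum x + y on the quadric
   exactly when the symplectic form w(x, y) = a.b' + a'.b equals 1, so this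
   graph on the ground set is first-order definable. It is quasirandom: the
   parity of the number of edges along the 4-cycle x0 x2 x1 x3 is
   w(x0 + x1, x2 + x3), which is balanced as soon as x0 <> x1. By compactness
   some subsequence of (M_n) is first order convergent. In a limit modeling the
   graph would be a measurable subset F of the square of a probability space,
   and g = 1 - 2 1_F would satisfy
     int g(x,y) g(x',y) g(x,y') g(x',y') = 0.
   By Fubini this forces int g u(x) w(y) = 0 for all bounded u and w, hence
   g = 0 almost everywhere, contradicting g^2 = 1. *)

(** * Bounded integrands on probability spaces *)

Section UnitBounded.
Context {R : realType}.

(** The bound 1 survives products, sections and partial integrals over a probability, so every
    integrand below is integrable and Fubini applies. *)
Definition unit_bounded d (T : measurableType d) (f : T -> R) : Prop :=
  measurable_fun setT f /\ forall x, `|f x| <= 1.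

Lemma unit_boundedM d (T : measurableType d) (f g : T -> R) :
  unit_bounded f -> unit_bounded g -> unit_bounded (fun x => f x * g x).
Proof.
move=> [mf bf] [mg bg]; split; first exact: measurable_funM.
by move=> x; rewrite normrM mulr_ile1.
Qed.

Lemma unit_bounded_comp d1 d2 (T1 : measurableType d1) (T2 : measurableType d2)
    (f : T2 -> R) (g : T1 -> T2) :
  measurable_fun setT g -> unit_bounded f -> unit_bounded (fun x => f (g x)).
Proof. by move=> mg [mf bf]; split => //; exact: measurableT_comp. Qed.

Lemma unit_bounded_indic d (T : measurableType d) (A : set T) :
  measurable A -> unit_bounded (\1_A : T -> R).
Proof.
move=> mA; split; first exact: measurable_indic.
by move=> x; rewrite indicE; case: (_ \in _); rewrite ?normr1 ?normr0.
Qed.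

Section OneSpace.
Context d (T : measurableType d) (P : probability T R).

Lemma integrable_unit_bounded (f : T -> R) :
  unit_bounded f -> P.-integrable setT (EFin \o f).
Proof.
move=> [mf bf]; apply: measurable_bounded_integrable => //.
  by rewrite [X in (X < _)%E]probability_setT ltry.
exists 1; split => // M M1 x _; exact: le_trans (bf x) (ltW M1).
Qed.

Lemma Rintegral_unit_bounded (f : T -> R) :
  unit_bounded f -> `|\int[P]_x f x| <= 1.
Proof.
move=> bf; apply: (le_trans (le_normr_Rintegral measurableT
  (integrable_unit_bounded bf))).
have bn : unit_bounded (fun x => `|f x|).
  by split; [exact: measurableT_comp bf.1|move=> x; rewrite normr_id bf.2].
have b1 : unit_bounded (cst 1 : T -> R) by split => // x; rewrite normr1.
apply: (le_trans (le_Rintegral measurableT (integrable_unit_bounded bn)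
   (integrable_unit_bounded b1) (fun x _ => bf.2 x))).
by rewrite Rintegral_cst// [X in fine X]probability_setT mul1r.
Qed.

Lemma Rintegral_indic_probability (A : set T) :
  measurable A -> \int[P]_x \1_A x = fine (P A).
Proof. by move=> mA; rewrite /Rintegral integral_indic// setIT. Qed.

(** A nonnegative function with integral zero vanishes almost everywhere; hence so do [f] and its
    product with any weight. *)
Lemma Rintegral_sqr_eq0 (f w : T -> R) : unit_bounded f -> unit_bounded w ->
  \int[P]_x f x ^+ 2 = 0 -> \int[P]_x (f x * w x) = 0.
Proof.
move=> bf bw f0.
have bff : unit_bounded (fun x => f x ^+ 2) by exact: unit_boundedM.
have bfw := unit_boundedM bf bw.
have : (\int[P]_x `|(EFin \o (fun x => (f x ^+ 2)%R)) x|)%E = 0%E.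
  under eq_integral do rewrite gee0_abs ?lee_fin ?sqr_ge0//.
  rewrite -[LHS]fineK; first by move: f0; rewrite /Rintegral => ->.
  exact/integrable_fin_num/integrable_unit_bounded.
move=> /ae_eq_integral_abs -/(_ measurableT) ff0.
have {}ff0 : ae_eq P setT (EFin \o (fun x => f x * w x)) (cst 0%E).
  apply: filterS (ff0 _); last exact/measurable_EFinP/bff.1.
  move=> x /= /(_ I) [] /eqP; rewrite sqrf_eq0 => /eqP fx0 _.
  by rewrite fx0 mul0r.
rewrite /Rintegral (ae_eq_integral (cst 0%E)) ?integral0//.
exact/measurable_EFinP/bfw.1.
Qed.

End OneSpace.

Section TwoSpaces.
Context d1 d2 (T1 : measurableType d1) (T2 : measurableType d2).
Variables (P1 : probability T1 R) (P2 : probability T2 R).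
Variables (f : T1 * T2 -> R) (bf : unit_bounded f).

Let If : (P1 \x P2)%E.-integrable setT (EFin \o f).
Proof. exact: integrable_unit_bounded. Qed.

Lemma unit_bounded_section1 x : unit_bounded (fun y => f (x, y)).
Proof. by apply: unit_bounded_comp bf; exact: pair1_measurable. Qed.

Lemma unit_bounded_section2 y : unit_bounded (fun x => f (x, y)).
Proof. by apply: unit_bounded_comp bf; exact: pair2_measurable. Qed.

Lemma unit_bounded_Rintegral1 : unit_bounded (fun x => \int[P2]_y f (x, y)).
Proof.
split; last by move=> x; exact/Rintegral_unit_bounded/unit_bounded_section1.
by apply: measurableT_comp (measurable_fubini_F If); exact: fine_measurable.
Qed.

Lemma unit_bounded_Rintegral2 : unit_bounded (fun y => \int[P1]_x f (x, y)).
Proof.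
split; last by move=> y; exact/Rintegral_unit_bounded/unit_bounded_section2.
by apply: measurableT_comp (measurable_fubini_G If); exact: fine_measurable.
Qed.

Lemma Rintegral_prod1 :
  \int[(P1 \x P2)%E]_z f z = \int[P1]_x \int[P2]_y f (x, y).
Proof.
rewrite /Rintegral -(fubini1 If); congr fine; apply: eq_integral => x _.
rewrite fineK//; apply: integrable_fin_num => //.
exact/integrable_unit_bounded/unit_bounded_section1.
Qed.

Lemma Rintegral_prod2 :
  \int[(P1 \x P2)%E]_z f z = \int[P2]_y \int[P1]_x f (x, y).
Proof.
rewrite /Rintegral -(fubini2 If); congr fine; apply: eq_integral => y _.
rewrite fineK//; apply: integrable_fin_num => //.
exact/integrable_unit_bounded/unit_bounded_section2.
Qed.

End TwoSpaces.
End UnitBounded.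

Ltac measurable_projections := apply: measurable_fun_pair;
  first [ exact: measurable_fst | exact: measurable_snd
        | exact: (measurableT_comp measurable_fst measurable_fst)
        | exact: (measurableT_comp measurable_snd measurable_fst)
        | exact: (measurableT_comp measurable_fst measurable_snd)
        | exact: (measurableT_comp measurable_snd measurable_snd) ].

(** * Quasirandom sets are not measurable *)

Section FourCycle.
Context {R : realType} d (T : measurableType d) (P : probability T R).

Let Q : probability (T * T)%type R := (P \x P)%E.

(** This is the equality case of the two Cauchy-Schwarz steps that bound cut norms by 4-cycle
    densities: each squared integral is exactly zero, so its base vanishes almost everywhere. *)
Lemma Rintegral_rectangle_eq0 (g : T * T -> R) (u w : T -> R) :
    unit_bounded g -> unit_bounded u -> unit_bounded w ->
    \int[(Q \x Q)%E]_z
      (g (z.1.1, z.2.1) * g (z.1.2, z.2.1) *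
       (g (z.1.1, z.2.2) * g (z.1.2, z.2.2))) = 0 ->
  \int[Q]_z (g z * u z.1 * w z.2) = 0.
Proof.
move=> bg bu bw c4.
pose G (z : (T * T) * T) := g (z.1.1, z.2) * g (z.1.2, z.2).
have bG : unit_bounded G.
  apply: unit_boundedM; apply: unit_bounded_comp bg;
    measurable_projections.
(* [h] is the signed codegree of a pair of vertices; for fixed [p] the 4-cycle integrand is
   [G (p, y) * G (p, y')], which integrates to [h p ^+ 2]. *)
pose h p := \int[P]_y G (p, y).
have bh : unit_bounded h by exact: (unit_bounded_Rintegral1 Q P bG).
have h0 : \int[Q]_p h p ^+ 2 = 0.
  rewrite -c4 Rintegral_prod1; last first.
    apply: unit_boundedM; apply: unit_boundedM; apply: unit_bounded_comp bg;
      measurable_projections.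
  apply: eq_Rintegral => p _ /=.
  have bGp : unit_bounded (fun y => G (p, y)) by exact: unit_bounded_section1.
  rewrite (Rintegral_prod1 P P (f := fun r => G (p, r.1) * G (p, r.2))).
    under eq_Rintegral do
      (rewrite /= RintegralZl; [|by []|exact: integrable_unit_bounded]).
    rewrite RintegralZr//; exact: integrable_unit_bounded.
  by apply: unit_boundedM; apply: unit_bounded_comp bGp.
pose k y := \int[P]_x (g (x, y) * u x).
have bgu : unit_bounded (fun z : T * T => g z * u z.1).
  by apply: unit_boundedM => //; exact: unit_bounded_comp bu.
have bk : unit_bounded k.
  exact: (unit_bounded_Rintegral2 P P bgu).
have k0 : \int[P]_y k y ^+ 2 = 0.
  have buu : unit_bounded (fun p : T * T => u p.1 * u p.2).
    by apply: unit_boundedM; apply: unit_bounded_comp bu.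
  have <- := Rintegral_sqr_eq0 bh buu h0.
  (* Integrating [H] over the pair first gives [k y ^+ 2]; integrating over [y] first gives [h p]
     times a bounded weight, whose integral is zero. *)
  pose H (z : (T * T) * T) := G z * (u z.1.1 * u z.1.2).
  have bH : unit_bounded H.
    apply: unit_boundedM => //.
    exact: (unit_bounded_comp (g := fst) _ buu).
  transitivity (\int[(Q \x P)%E]_z H z).
    rewrite Rintegral_prod2//; apply: eq_Rintegral => y _.
    have bguy : unit_bounded (fun x => g (x, y) * u x).
      exact: (unit_bounded_section2 bgu y).
    have -> : \int[Q]_p H (p, y) = \int[Q]_p
        ((g (p.1, y) * u p.1) * (g (p.2, y) * u p.2)).
      by apply: eq_Rintegral => p _; rewrite /H /G /=; ring.
    rewrite Rintegral_prod1; last first.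
      exact: (unit_boundedM (unit_bounded_comp (g := fst) _ bguy)
                            (unit_bounded_comp (g := snd) _ bguy)).
    under eq_Rintegral do
      (rewrite /= RintegralZl; [|by []|exact: integrable_unit_bounded]).
    by rewrite RintegralZr//; exact: integrable_unit_bounded.
  rewrite Rintegral_prod1//; apply: eq_Rintegral => p _.
  rewrite /H /= RintegralZr//; apply: integrable_unit_bounded.
  exact: unit_bounded_section1.
rewrite (Rintegral_prod2 P P (f := fun z => g z * u z.1 * w z.2)).
  rewrite -[RHS](Rintegral_sqr_eq0 bk bw k0); apply: eq_Rintegral => y _ /=.
  rewrite RintegralZr//; apply: integrable_unit_bounded.
  exact: (unit_bounded_section2 bgu y).
by apply: unit_boundedM => //; exact: unit_bounded_comp bw.
Qed.

Definition set_sign (F : set (T * T)) (z : T * T) : R := 1 - 2 * \1_F z.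

Lemma unit_bounded_sign (F : set (T * T)) :
  measurable F -> unit_bounded (set_sign F).
Proof.
move=> mF; split.
  by apply: measurable_funB => //; apply: measurable_funM => //;
    exact: measurable_indic.
move=> z; rewrite /set_sign indicE; case: (_ \in _) => /=;
  rewrite ?mulr0 ?mulr1 ler_norml; apply/andP; split; lra.
Qed.

(* The integral vanishes on rectangles, so [F] has relative density 1/2 in every
   measurable set, including [F] and its complement. *)
Lemma Rintegral_cycle4_neq0 (F : set (T * T)) : measurable F ->
  let g := set_sign F in
  \int[(Q \x Q)%E]_z
      (g (z.1.1, z.2.1) * g (z.1.2, z.2.1) *
       (g (z.1.1, z.2.2) * g (z.1.2, z.2.2))) <> 0.
Proof.
move=> mF g c4.
have bg : unit_bounded g by exact: unit_bounded_sign.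
(* [m'] is twice [Q] restricted to [F]. Agreement with [P \x P] on rectangles forces agreement on
   all measurable sets. *)
pose m' : {measure set (T * T) -> \bar R} :=
  mscale (NngNum (ler0n R 2)) (mrestr Q mF).
have rect A B : measurable A -> measurable B ->
    m' (A `*` B) = (P A * P B)%E.
  move=> mA mB.
  have mAB : measurable (A `*` B) by exact: measurableX.
  have mABF : measurable (A `*` B `&` F) by exact: measurableI.
  have := Rintegral_rectangle_eq0 bg (unit_bounded_indic mA)
    (unit_bounded_indic mB) c4.
  have -> : \int[Q]_z (g z * \1_A z.1 * \1_B z.2) =
     \int[Q]_z (\1_(A `*` B) z - 2 * \1_(A `*` B `&` F) z).
    apply: eq_Rintegral => z _.
    rewrite /g /set_sign !indicE in_setI in_setX.
    by do 3 case: (_ \in _) => /=; lra.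
  rewrite RintegralB//=; last 2 first.
  - exact/integrable_unit_bounded/unit_bounded_indic.
  - exact: (integrableZl measurableT 2
      (integrable_unit_bounded Q (unit_bounded_indic mABF))).
  rewrite RintegralZl//; last exact/integrable_unit_bounded/unit_bounded_indic.
  rewrite /Rintegral !integral_indic// !setIT => /eqP; rewrite subr_eq0 => /eqP.
  rewrite -[_ * _]/(fine 2%:E * _) -fineM ?fin_num_measure// => ABF.
  have : Q (A `*` B) = (2%:E * Q (A `*` B `&` F))%E.
    by rewrite -[LHS]fineK ?ABF ?fineK ?fin_numM ?fin_num_measure.
  by rewrite [X in X = _ -> _]product_measure1E// => ->.
have E := product_measure_unique rect.
have QF : Q F = (2%:E * Q F)%E.
  by rewrite [LHS]E//= /mscale/= /mrestr/= setIid.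
have QF' : Q (~` F) = 0%E.
  rewrite [LHS]E//=; last exact: measurableC.
  by rewrite /mscale/= /mrestr setICl measure0 mule0.
have := probability_setC Q mF; rewrite [X in X = _ -> _]QF'.
move: QF; rewrite -[Q F]fineK ?fin_num_measure//.
set q := fine _; move=> [q1] [q2]; lra.
Qed.
End FourCycle.

(** * Product measures on tuples *)

Definition pair_proj (T : Type) k (i j : 'I_k) (x : k.-tuple T) : 2.-tuple T :=
  [tuple tnth x i; tnth x j].

(* The measure structure of [pushforward] depends on the proof [mf], which
   unification cannot infer. *)
Definition image_measure d1 d2 (T1 : measurableType d1) (T2 : measurableType d2)
    (R : realType) (m : {measure set T1 -> \bar R}) (f : T1 -> T2)
    (mf : measurable_fun setT f) : {measure set T2 -> \bar R} :=
  measure_function_pushforward__canonical__measure_function_Measure m mf.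

Section TupleMeasure.
Context {R : realType} d (T : measurableType d).

Definition rectangle k (A : 'I_k -> set T) : set (k.-tuple T) :=
  [set x | forall i, A i (tnth x i)].

Lemma measurable_rectangle k (A : 'I_k -> set T) :
  (forall i, measurable (A i)) -> measurable (rectangle A).
Proof.
move=> mA; rewrite (_ : rectangle A = \bigcap_i ((@tnth k T)^~ i @^-1` A i)).
  apply: fin_bigcap_measurable => [|i _]; first exact: finite_finset.
  by rewrite -[X in measurable X]setTI; exact: measurable_tnth.
by apply/seteqP; split => [x Ax i _|x Ax i]; [exact: Ax|exact: (Ax i)].
Qed.

(** Rectangles are stable under intersection and generate the tuple sigma-algebra, since a
    coordinate preimage is a rectangle with one proper side. *)
Lemma tuple_measure_unique k (m1 m2 : {measure set (k.-tuple T) -> \bar R}) :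
    (m1 setT < +oo)%E ->
    (forall A, (forall i, measurable (A i)) ->
       m1 (rectangle A) = m2 (rectangle A)) ->
  forall B, measurable B -> m1 B = m2 B.
Proof.
move=> m1fin m12 B mB.
pose G : set (set (k.-tuple T)) :=
  [set C | exists2 A, (forall i, measurable (A i)) & C = rectangle A].
have GT : G setT.
  by exists (fun=> setT) => //; apply/seteqP; split.
apply: (measure_unique G (fun=> setT)) => //.
- apply/seteqP; split.
    apply: smallest_sub; first exact: smallest_sigma_algebra.
    rewrite -bigcup_seq => _ [i /= _ [Y mY <-]].
    apply: sub_sigma_algebra; exists (fun j => if j == i then Y else setT).
      by move=> j; case: ifP.
    apply/seteqP; split => [x [_ Yx] j|x /(_ i)]; last by rewrite eqxx.
    by case: eqP => // ->.
  apply: smallest_sub; first exact: sigma_algebra_measurable.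
  by move=> _ [A mA ->]; exact: measurable_rectangle.
- move=> _ _ [A mA ->] [A' mA' ->]; exists (fun i => A i `&` A' i).
    by move=> i; exact: measurableI.
  apply/seteqP; split => [x [Ax A'x] i|x AA']; first by split.
  by split => i; have [] := AA' i.
- by apply/seteqP; split => // x _; exists 0%N.
- by move=> _ [A mA ->]; exact: m12.
Qed.

Lemma measurable_pair_proj k (i j : 'I_k) :
  measurable_fun setT (@pair_proj T k i j).
Proof.
by apply/measurable_fun_tnthP => -[[|[|l]] ll] //; exact: measurable_tnth.
Qed.

Section ProductMeasures.
Variables (nu : {measure set T -> \bar R})
  (mu : forall k : nat, {measure set (k.-tuple T) -> \bar R}).
Hypotheses (nu1 : nu setT = 1%E) (mu_prod : is_product_measures nu mu).

Lemma product_measuresT k : mu k setT = 1%E.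
Proof.
rewrite (_ : setT = rectangle (fun=> setT)); last by apply/seteqP; split.
by rewrite [LHS]mu_prod// big1.
Qed.

(** The coordinates other than [i] and [j] contribute factors [nu setT = 1]. The lemma carries null
    sets of pairs to null sets of 4-tuples. *)
Lemma product_measures_pair k (i j : 'I_k) (B : set (2.-tuple T)) :
  i != j -> measurable B -> mu k (pair_proj i j @^-1` B) = mu 2 B.
Proof.
move=> ij mB; have mp := measurable_pair_proj i j.
pose m' := image_measure (mu k) mp.
rewrite -[LHS]/(m' B); apply/esym/tuple_measure_unique => //.
  by rewrite [X in (X < _)%E]product_measuresT ltry.
move=> A mA; rewrite [LHS]mu_prod//.
pose A' l := if l == i then A ord0 else if l == j then A ord_max else setT.
have mA' l : measurable (A' l) by rewrite /A'; do 2 case: ifP => //.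
have -> : m' (rectangle A) = mu k (rectangle A').
  congr (mu k _); apply/seteqP; split => [x Ax l|x A'x l].
    rewrite /A'; case: eqP => [->|_]; first exact: (Ax ord0).
    by case: eqP => // ->; exact: (Ax ord_max).
  case: l => -[|[|l]] ll //=.
    by have := A'x i; rewrite /A' eqxx; congr (A _ _); exact: val_inj.
  have := A'x j; rewrite /A' eqxx eq_sym (negbTE ij).
  by congr (A _ _); exact: val_inj.
transitivity (nu (A ord0) * nu (A ord_max))%E.
  rewrite !big_ord_recl big_ord0 mule1.
  by congr (_ * nu (A _))%E; exact: val_inj.
rewrite [RHS]mu_prod// (bigD1 i)//= (bigD1 j) 1?eq_sym//= big1 => [|l].
  by rewrite mule1 /A' !eqxx eq_sym (negbTE ij).
by move=> /andP[/negbTE li /negbTE lj]; rewrite /A' li lj.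
Qed.

End ProductMeasures.
End TupleMeasure.

Section ToProbability.
Context {R : realType} d (T : measurableType d).
Variables (nu : {measure set T -> \bar R}) (nu1 : nu setT = 1%E).

Let nu_fun : set T -> \bar R := nu.
HB.instance Definition _ := Measure.on nu_fun.
HB.instance Definition _ := Measure_isProbability.Build _ _ _ nu_fun nu1.

Definition to_probability : probability T R := nu_fun.

End ToProbability.

(** * Parity of a measurable relation along 4-cycles *)

Section CycleParity.
Context {R : realType} d (T : measurableType d).

(** All four pairs are oriented from {x0, x1} to {x2, x3}, so that the sign of this parity is the
    product of the four values of [set_sign] in the 4-cycle integral. *)
Definition cycle_parity (T : Type) (S : set (2.-tuple T)) (x : 4.-tuple T)
    : bool :=
  let s (i j : nat) (hi : (i < 4)%N) (hj : (j < 4)%N) :=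
    `[< S (pair_proj (Ordinal hi) (Ordinal hj) x) >] in
  (s 0 2 isT isT (+) s 1 2 isT isT) (+) (s 0 3 isT isT (+) s 1 3 isT isT).

Lemma measurable_addb d' (U : measurableType d') (a b : U -> bool) :
  measurable [set x | a x] -> measurable [set x | b x] ->
  measurable [set x | a x (+) b x].
Proof.
move=> ma mb.
rewrite (_ : [set x | a x (+) b x] = ([set x | a x] `\` [set x | b x]) `|`
   ([set x | b x] `\` [set x | a x])).
  by apply: measurableU; exact: measurableD.
apply/seteqP; split => x /=.
  by case: (a x); case: (b x) => //= _; [left|right].
by case=> -[]; case: (a x); case: (b x) => // _ /(_ isT).
Qed.

Lemma measure_eq_mod_null d' (U : measurableType d')
    (m : {measure set U -> \bar R}) (A B N : set U) :
    measurable A -> measurable B -> measurable N -> m N = 0%E ->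
    A `<=` B `|` N -> B `<=` A `|` N -> m A = m B.
Proof.
move=> mA mB mN mN0 AB BA; apply/eqP; rewrite eq_le; apply/andP; split.
  apply: (le_trans (le_measure m _ _ AB)); rewrite ?inE//.
    exact: measurableU.
  by apply: (le_trans (measureU2 _ _ _)); rewrite // [X in (_ + X)%E]mN0 adde0.
apply: (le_trans (le_measure m _ _ BA)); rewrite ?inE//.
  exact: measurableU.
by apply: (le_trans (measureU2 _ _ _)); rewrite // [X in (_ + X)%E]mN0 adde0.
Qed.

(** If odd cycles had measure 1/2, the 4-cycle integral of a measurable version of [S] would be
    [1 - 2 * (1 / 2) = 0], against [Rintegral_cycle4_neq0]. *)
Lemma cycle_parity_neq_half (nu : {measure set T -> \bar R})
    (mu : forall k : nat, {measure set (k.-tuple T) -> \bar R})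
    (S : set (2.-tuple T)) (m2 m4 : \bar R) :
    nu setT = 1%E -> is_product_measures nu mu ->
    cmeasure (mu 2) S m2 ->
    cmeasure (mu 4) [set x | cycle_parity S x] m4 ->
  fine m4 <> 1 / 2.
Proof.
move=> nu1 mu_prod [B2 [N2 [mB2 mN2 N20 SB2 _]]].
move=> [B4 [N4 [mB4 mN4 N40 SB4 <-]]].
pose P : probability T R := to_probability nu1.
pose Q : probability (T * T)%type R := (P \x P)%E.
pose QQ : probability ((T * T) * (T * T))%type R := (Q \x Q)%E.
(* The grouping (x0, x1), (x2, x3) matches the iterated product used in the 4-cycle integral. *)
pose Phi (z : (T * T) * (T * T)) := [tuple z.1.1; z.1.2; z.2.1; z.2.2].
have mPhi : measurable_fun setT Phi.
  apply/measurable_fun_tnthP => -[[|[|[|[|i]]]] hi] //.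
  - exact: (measurableT_comp measurable_fst measurable_fst).
  - exact: (measurableT_comp measurable_snd measurable_fst).
  - exact: (measurableT_comp measurable_fst measurable_snd).
  - exact: (measurableT_comp measurable_snd measurable_snd).
have mu4E B : measurable B -> mu 4 B = QQ (Phi @^-1` B).
  apply: (tuple_measure_unique (m2 := image_measure QQ mPhi)).
    by rewrite [X in (X < _)%E](product_measuresT nu1 mu_prod) ltry.
  move=> A mA; rewrite [LHS]mu_prod// !big_ord_recl big_ord0 mule1.
  set A0 := A _; set A1 := A _; set A2 := A _; set A3 := A _.
  have mA0 : measurable A0 by exact: mA.
  have mA1 : measurable A1 by exact: mA.
  have mA2 : measurable A2 by exact: mA.
  have mA3 : measurable A3 by exact: mA.
  have -> : image_measure QQ mPhi (rectangle A) =
      QQ ((A0 `*` A1) `*` (A2 `*` A3)).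
    congr (QQ _); apply/seteqP; split => [z Az|z [[z0 z1] [z2 z3]]].
      by split; split; [exact: Az ord0| exact: (Az (lift ord0 ord0))|
         exact: (Az (lift ord0 (lift ord0 ord0)))|
         exact: (Az (lift ord0 (lift ord0 (lift ord0 ord0))))].
    case => -[|[|[|[|i]]]] hi //.
    - by move: z0; congr (A _ _); exact: val_inj.
    - by move: z1; congr (A _ _); exact: val_inj.
    - by move: z2; congr (A _ _); exact: val_inj.
    - by move: z3; congr (A _ _); exact: val_inj.
  have QE A' B' : measurable A' -> measurable B' ->
    Q (A' `*` B') = (nu A' * nu B')%E by exact: product_measure1E.
  transitivity (Q (A0 `*` A1) * Q (A2 `*` A3))%E.
    by rewrite !QE// !muleA.
  by apply/esym/product_measure1E; exact: measurableX.
pose C := [set x | cycle_parity B2 x].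
have mC : measurable C.
  have mB (i j : 'I_4) : measurable [set x | `[< B2 (pair_proj i j x) >]].
    rewrite (_ : [set x | _] = pair_proj i j @^-1` B2).
      by rewrite -[X in measurable X]setTI; exact: measurable_pair_proj.
    by apply/seteqP; split => x /asboolP.
  by apply: measurable_addb; apply: measurable_addb; exact: mB.
pose N i j : set (4.-tuple T) := pair_proj i j @^-1` N2.
have mN i j : measurable (N i j).
  by rewrite -[X in measurable X]setTI; exact: measurable_pair_proj.
have N0 i j : i != j -> mu 4 (N i j) = 0%E.
  by move=> ij; rewrite /N (product_measures_pair nu1 mu_prod).
(* The two sets differ only inside [N4] and the preimages of [N2] under the four edge projections,
   all of them null. *)
have B4C : mu 4 B4 = mu 4 C.
  pose i0 : 'I_4 := @Ordinal 4 0 isT; pose i1 : 'I_4 := @Ordinal 4 1 isT.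
  pose i2 : 'I_4 := @Ordinal 4 2 isT; pose i3 : 'I_4 := @Ordinal 4 3 isT.
  pose N' := N4 `|` (N i0 i2 `|` N i1 i2 `|` (N i0 i3 `|` N i1 i3)).
  have mN' : measurable N' by do ?apply: measurableU.
  have N'0 : mu 4 N' = 0%E.
    have U0 A B : measurable A -> measurable B ->
        mu 4 A = 0%E -> mu 4 B = 0%E -> mu 4 (A `|` B) = 0%E.
      by move=> mA mB A0 B0; rewrite measureU0.
    have N02 i j k l : i != j -> k != l -> mu 4 (N i j `|` N k l) = 0%E.
      by move=> ij kl; apply: U0 => //; exact: N0.
    apply: (U0) => //; first by do ?apply: measurableU.
    by apply: U0; [exact: measurableU|exact: measurableU|exact: N02|exact: N02].
  have SB i j x : ~ N i j x ->
      `[< S (pair_proj i j x) >] = `[< B2 (pair_proj i j x) >].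
    move=> nN; apply: asbool_equiv_eq; split => h; apply: contrapT => h';
      apply/nN/SB2; [by left|by right].
  have CS x : ~ N' x -> cycle_parity S x = cycle_parity B2 x.
    move=> /not_orP[_] /not_orP[/not_orP[n02 n12] /not_orP[n03 n13]].
    by rewrite /cycle_parity !SB.
  apply: (@measure_eq_mod_null _ _ (mu 4) _ _ N') => // x xB.
    have [xN|xN] := pselect (N' x); [by right|left].
    rewrite /C /= -CS//; apply: contrapT => xS; apply: xN; left.
    by apply: SB4; right.
  have [xN|xN] := pselect (N' x); [by right|left].
  apply: contrapT => xB4; apply: (xN); left; apply: SB4; left; split => //=.
  by rewrite CS.
rewrite [X in fine X]B4C mu4E// => half.
pose F : set (T * T) := [set z | B2 [tuple z.1; z.2]].
have mF : measurable F.
  have mpr : measurable_fun setT (fun z : T * T => [tuple z.1; z.2]).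
    apply/measurable_fun_tnthP => -[[|[|i]] hi] //.
    - exact: measurable_fst.
    - exact: measurable_snd.
  by rewrite -[X in measurable X]setTI; exact: mpr.
apply: (@Rintegral_cycle4_neq0 R d T P F mF).
have mPC : measurable (Phi @^-1` C).
  by rewrite -[X in measurable X]setTI; exact: mPhi.
(* A product of four signs is the sign of the exclusive or. *)
transitivity (\int[QQ]_z (1 - 2 * \1_(Phi @^-1` C) z)).
  apply: eq_Rintegral => z _.
  have inE' U (A : set U) a : (a \in A) = `[< A a >].
    by apply/idP/asboolP; rewrite inE.
  rewrite /set_sign !indicE !inE' /preimage /C /= asboolb.
  have -> : cycle_parity B2 (Phi z) =
      (`[<F (z.1.1, z.2.1)>] (+) `[<F (z.1.2, z.2.1)>]) (+)
      (`[<F (z.1.1, z.2.2)>] (+) `[<F (z.1.2, z.2.2)>]) by [].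
  by do 4 case: asbool => /=; lra.
rewrite RintegralB//=; last 2 first.
- have b1 : unit_bounded (cst 1 : (T * T) * (T * T) -> R).
    by split => // z; rewrite normr1.
  exact: (integrable_unit_bounded QQ b1).
- exact: (integrableZl measurableT 2
      (integrable_unit_bounded QQ (unit_bounded_indic mPC))).
rewrite RintegralZl//; last first.
  exact: (integrable_unit_bounded QQ (unit_bounded_indic mPC)).
rewrite Rintegral_cst// [X in fine X](_ : _ = 1%E); last exact: (probability_setT QQ).
by rewrite (Rintegral_indic_probability QQ mPC) half /=; lra.
Qed.
End CycleParity.

(** * First order formulas and convergent subsequences *)

Section DiagonalSubsequence.
Context {R : realType}.

(** A free ultrafilter replaces nested subsequences: along it every [u i] has a limit by compactness
    of [0, 1], and finitely many indices at a time can be approximated at a common large [m]. *)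
Lemma convergent_diagonal (I : Type) (c : I -> nat) (u : I -> nat -> R) :
    injective c -> (forall i n, 0 <= u i n <= 1) ->
  exists2 s : nat -> nat, (forall n, (n <= s n)%N) &
    forall i, cvgn (fun n => u i (s n)).
Proof.
move=> c_inj u01.
have [U [UU noU]] := ultraFilterLemma eventually_filter.
have ulim i : exists l : R, u i @ U --> l.
  have U_PF : ProperFilter (u i @ U) by exact: fmap_proper_filter.
  have [|l [_ cl_l]] := @segment_compact R 0 1 (u i @ U) U_PF.
    by apply: (@filterS _ U _ setT); [move=> n _; rewrite /= in_itv/=; exact: u01|
      exact: filterT].
  exists l; apply/cvgrPdist_lt => e e0.
  (* A cluster point of an ultrafilter is a limit: if the complement of a ball around [l] were
     large, it would have to meet that ball. *)
  have [//|Ue] := in_ultra_setVsetC [set n | `|l - u i n| < e] UU.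
  have ball_l : nbhs l [set x | `|l - x| < e] by exact: nbhsx_ballx.
  by have [|x []] := cl_l (~` [set x | `|l - x| < e]) _ _ ball_l.
have [l ul] := choice ulim.
have near_below n : \forall m \near U, forall i, (c i < n)%N ->
    `|l i - u i m| < n.+1%:R^-1.
  suff all_below k : \forall m \near U, forall i, (c i < k)%N ->
    `|l i - u i m| < n.+1%:R^-1 by exact: all_below.
  (* As [c] is injective, each step adds at most one index, so only finite intersections are
     taken. *)
  elim: k => [|k IHk]; first exact: filterE.
  have [[i ci]|nk] := pselect (exists i, c i = k).
    have : \forall m \near U, `|l i - u i m| < n.+1%:R^-1.
      by move/cvgrPdist_lt : (ul i) => /(_ n.+1%:R^-1); apply.
    apply: filterS2 IHk => m IHm uim j; rewrite ltnS leq_eqVlt.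
    by move=> /predU1P[|/IHm//]; rewrite -ci => /c_inj ->.
  apply: filterS IHk => m IHm j; rewrite ltnS leq_eqVlt.
  by move=> /predU1P[cj|/IHm//]; case: nk; exists j.
have sE n : exists m, (n <= m)%N /\ forall i, (c i < n)%N ->
    `|l i - u i m| < n.+1%:R^-1.
  have Un : U [set m | (n <= m)%N] by apply: noU; exact: nbhs_infty_ge.
  by have [m [? ?]] := filter_ex (filterI Un (near_below n)); exists m.
have [s sP] := choice sE; exists s => [n|i]; first by have [] := sP n.
apply/cvg_ex; exists (l i); apply/cvgrPdist_lt => e e0.
near=> n.
have [_ sn] := sP n.
apply: (lt_trans (sn i _)).
  by near: n; exact: nbhs_infty_gt.
by near: n; exact: near_infty_natSinv_lt (PosNum e0).
Unshelve. all: by end_near. Qed.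

End DiagonalSubsequence.

(** Generic trees over [nat] form a countable type, so this encoding lets [pickle] number the
    formulas. *)
Fixpoint formula_tree (f : formula) : GenTree.tree nat :=
  match f with
  | FRel k v => GenTree.Node 0 [seq GenTree.Leaf (v i) | i <- enum 'I_k.+1]
  | FEq i j => GenTree.Node 1 [:: GenTree.Leaf i; GenTree.Leaf j]
  | FNeg g => GenTree.Node 2 [:: formula_tree g]
  | FAnd g h => GenTree.Node 3 [:: formula_tree g; formula_tree h]
  | FEx i g => GenTree.Node 4 [:: GenTree.Leaf i; formula_tree g]
  end.

Lemma formula_tree_inj : injective formula_tree.
Proof.
elim=> [k v|i j|g IHg|g IHg h IHh|i g IHg] [k' v'|i' j'|g'|g' h'|i' g'] //=.
- move=> [vv'].
  (* The arity is recovered from the number of leaves; only then do [v] and [v'] have the same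
     type. *)
  have kk' : k = k'.
    by move: (congr1 size vv'); rewrite [LHS]size_map [RHS]size_map !size_enum_ord => -[].
  rewrite -{k'}kk' in v' vv' *; congr FRel; apply/funext => i.
  by have /eq_in_map/(_ i (mem_enum _ _)) [] := vv'.
- by move=> [-> ->].
- by move=> [/IHg ->].
- by move=> [/IHg -> /IHh ->].
- by move=> [-> /IHg ->].
Qed.

Lemma stone_fin01 (R : realType) (E : finType) (I : lstructure E) k f :
  0 <= stone_fin R I k f <= 1.
Proof.
rewrite /stone_fin divr_ge0//=.
have [->|Ek0] := eqVneq (#|E| ^ k)%N 0%N; first by rewrite invr0 mulr0.
by rewrite ler_pdivrMr ?ltr0n ?lt0n// mul1r ler_nat -card_tuple max_card.
Qed.

Lemma FO_convergent_subsequence (R : realType) (E : nat -> finType)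
    (indep : forall n, {set E n} -> bool) :
  exists2 s : nat -> nat, (forall n, (n <= s n)%N) &
    FO_convergent R (fun n => E (s n)) (fun n => indep (s n)).
Proof.
pose c (kf : nat * formula) := pickle (kf.1, formula_tree kf.2).
have c_inj : injective c.
  move=> [k f] [k' f'] /(pcan_inj pickleK) [-> /formula_tree_inj ->] //.
have [|s ns cs] := convergent_diagonal
  (u := fun kf n => stone_fin R (fin_mstruct (indep n)) kf.1 kf.2) c_inj.
  by move=> kf n; exact: stone_fin01.
by exists s => // k f _; exact: (cs (k, f)).
Qed.

(** * Defining the graph and its odd 4-cycles by formulas *)

Definition FXor (f g : formula) : formula :=
  FNeg (FAnd (FNeg (FAnd f (FNeg g))) (FNeg (FAnd (FNeg f) g))).

Lemma fv_xor f g k : fv_below (FXor f g) k = fv_below f k && fv_below g k.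
Proof. by rewrite /fv_below /= !all_cat andbb. Qed.

Lemma sat_xor T (I : lstructure T) a f g :
  `[< sat I a (FXor f g) >] = `[< sat I a f >] (+) `[< sat I a g >].
Proof.
rewrite /=; apply/idP/idP => [/asboolP|].
  by case: asboolP; case: asboolP => //=; tauto.
by move=> h; apply/asboolP; move: h; case: asboolP; case: asboolP => //=; tauto.
Qed.

(* In a simple binary matroid: [x], [y] and [x + y] are distinct elements. *)
Definition third_point_formula (i j : nat) : formula :=
  FAnd (FNeg (FEq i j))
    (FEx 4 (FAnd (FNeg (FRel (fun l : 'I_3 => nth 0%N [:: i; j; 4] l)))
      (FAnd (FNeg (FEq 4 i)) (FNeg (FEq 4 j))))).

(** [I 2] is the ternary relation and also fails on repeated elements; the inequalities leave linear
    dependence as the only reason for failure. *)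
Definition third_point (T : Type) (I : lstructure T) (x y : T) : Prop :=
  x <> y /\ exists z, ~ I 2 (fun l : 'I_3 => nth z [:: x; y; z] l) /\
    (z <> x /\ z <> y).

(** The quantifier binds variable 4, which must not capture [i] or [j]; the cycle uses variables 0
    to 3. *)
Lemma sat_third_point T (I : lstructure T) a i j : i != 4 -> j != 4 ->
  sat I a (third_point_formula i j) <-> third_point I (a i) (a j).
Proof.
move=> /negbTE i4 /negbTE j4; rewrite /third_point /= i4 j4.
suff E z : (fun l : 'I_3 => if nth 0%N [:: i; j; 4] l == 4 then z
    else a (nth 0%N [:: i; j; 4] l)) = (fun l => nth z [:: a i; a j; z] l).
  by split=> -[? [z]]; [rewrite E|rewrite -E]; split=> //; exists z.
by apply/funext => -[[|[|[|l]]] hl] //=; rewrite ?i4 ?j4.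
Qed.

Definition cycle_formula : formula :=
  FXor (FXor (third_point_formula 0 2) (third_point_formula 1 2))
       (FXor (third_point_formula 0 3) (third_point_formula 1 3)).

Lemma fv_third_point i j k : (i < k)%N -> (j < k)%N ->
  fv_below (third_point_formula i j) k.
Proof.
move=> ik jk; apply/allP => n /=; rewrite !inE mem_filter !mem_cat !inE.
move=> /or3P[/eqP->|/eqP->|/andP[n4]]//.
rewrite (negbTE n4)/= => /or3P[/mapP[l _ nE]|/eqP->|/eqP->]//.
by move: l nE n4 => [[|[|[|l]]] hl] //= ->.
Qed.

Lemma fv_cycle : fv_below cycle_formula 4.
Proof. by rewrite !fv_xor !fv_third_point. Qed.

Lemma dset_third_point T (I : lstructure T) (x y : T) :
  dset I 2 (third_point_formula 0 1) [tuple x; y] <-> third_point I x y.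
Proof.
split=> [/(_ (fun n => nth x [:: x; y] n))|xy a axy].
  by move=> h; apply/(sat_third_point _ (fun n => nth x [:: x; y] n) (i:=0) (j:=1));
    [..|apply: h => -[[|[|l]] hl]].
by apply/sat_third_point => //; have := axy ord0; have := axy ord_max => /= -> ->.
Qed.

(** [dset] ranges over all assignments extending the tuple, but the truth value depends on the first
    four entries only, so a single assignment decides. *)
Lemma dset_cycle T (I : lstructure T) :
  dset I 4 cycle_formula =
    [set x | cycle_parity (dset I 2 (third_point_formula 0 1)) x].
Proof.
have E (x : 4.-tuple T) (a : nat -> T) : (forall i : 'I_4, a i = tnth x i) ->
    `[< sat I a cycle_formula >] =
    cycle_parity (dset I 2 (third_point_formula 0 1)) x.
  move=> ax; rewrite /cycle_formula !sat_xor.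
  have S (i j : nat) (hi : (i < 4)%N) (hj : (j < 4)%N) :
      `[< sat I a (third_point_formula i j) >] =
      `[< dset I 2 (third_point_formula 0 1)
            (pair_proj (Ordinal hi) (Ordinal hj) x) >].
    apply: asbool_equiv_eq; rewrite dset_third_point -!ax.
    by apply: sat_third_point; rewrite neq_ltn ?hi ?hj.
  by rewrite (S 0%N 2%N isT isT) (S 1%N 2%N isT isT) (S 0%N 3%N isT isT) (S 1%N 3%N isT isT).
apply/seteqP; split => [x|x Cx a ax]; last by apply/asboolP; rewrite (E x).
move=> h; have x0 : T := tnth x ord0.
pose a n := nth x0 x n.
have ax (i : 'I_4) : a i = tnth x i by rewrite /a -tnth_nth.
by rewrite /= -(E x a ax); apply/asboolP; exact: h.
Qed.

(** In a limit modeling, uniqueness of limits would give the odd 4-cycles of a definable graph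
    measure exactly 1/2. *)
Lemma no_limit_matroid_modeling (R : realType) (E : nat -> finType)
    (indep : forall n, {set E n} -> bool) :
    (fun n => stone_fin R (fin_mstruct (indep n)) 4 cycle_formula)
      @ \oo --> (1 / 2 : R) ->
  ~ has_limit_matroid_modeling R E indep.
Proof.
move=> half [d [T [I [nu [mu [[_ nu1 mu_prod modI] _ limI]]]]]].
have [m2 S2] := modI 2 _ (fv_third_point (isT : 0 < 2)%N (isT : 1 < 2)%N).
have [m4 [S4 lim4]] := limI 4 _ fv_cycle.
rewrite dset_cycle in S4.
apply: (cycle_parity_neq_half nu1 mu_prod S2 S4).
exact: cvg_unique lim4 half.
Qed.

(** * The symplectic graph of a quadric *)

Section VectorMatroid.
Context (K : fieldType) (V : vectType K) (E : finType) (phi : E -> V).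

Definition vector_indep (S : {set E}) : bool := free [seq phi x | x <- enum S].

Lemma vector_indepU1 (A : {set E}) x : x \notin A ->
  vector_indep (x |: A) = free (phi x :: [seq phi y | y <- enum A]).
Proof.
move=> xA; apply: perm_free; rewrite -[_ :: _]/(map phi (x :: enum A)).
apply: perm_map; apply: uniq_perm; rewrite /= ?mem_enum ?xA ?enum_uniq//.
by move=> y; rewrite mem_enum !inE mem_enum.
Qed.

Lemma fin_matroid_vector : fin_matroid vector_indep.
Proof.
split=> [|A B iB AB|A B iA iB AB].
- by rewrite /vector_indep enum_set0 nil_free.
- move: iB; rewrite /vector_indep.
  rewrite (@perm_free _ _ _ [seq phi x | x <- enum A ++ enum (B :\: A)]).
    by rewrite map_cat => /catl_free.
  apply/perm_map/uniq_perm; rewrite ?cat_uniq ?enum_uniq ?andbT//=.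
    by apply/hasPn => x; rewrite !mem_enum !inE => /andP[].
  move=> x; rewrite mem_cat !mem_enum !inE.
  have [/(fintype.subsetP AB)->|] := boolP (x \in A) => //.
(* Otherwise the span of [B] lies in that of [A], and the dimensions, equal to the cardinalities by
   freeness, contradict [#|A| < #|B|]. *)
- have [x xB xA] : exists2 x, x \in B &
      phi x \notin <<[seq phi y | y <- enum A]>>%VS.
    apply/exists_inP; rewrite -[X in is_true X]negbK negb_exists_in.
    apply/negP => /forall_inP allA.
    have : (<<[seq phi y | y <- enum B]>> <= <<[seq phi y | y <- enum A]>>)%VS.
      apply/span_subvP => _ /mapP[y + ->]; rewrite mem_enum => yB.
      by have := allA y yB; rewrite negbK.
    move=> /dimvS; move: iA iB; rewrite /vector_indep /free => /eqP-> /eqP->.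
    by rewrite !size_map -!cardE leqNgt AB.
  have nxA : x \notin A.
    by apply: contra xA => xA; apply/memv_span/map_f; rewrite mem_enum.
  exists x; first by rewrite !inE nxA.
  by rewrite vector_indepU1// free_cons xA.
Qed.

End VectorMatroid.

Lemma F2P (a : 'F_2) : a = 0 \/ a = 1.
Proof. by case: a => -[|[|a]] ha //; [left|right]; exact: val_inj. Qed.

Lemma F2_addb (a b : 'F_2) : (a + b == 1) = (a == 1) (+) (b == 1).
Proof. by have [->|->] := F2P a; have [->|->] := F2P b. Qed.

Lemma F2_double (a : 'F_2) : a + a = 0.
Proof. by have [->|->] := F2P a; exact: val_inj. Qed.

Lemma F2_addrr (V : lmodType 'F_2) (v : V) : v + v = 0.
Proof.
by rewrite -[v]scale1r -scalerDl F2_double scale0r.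
Qed.

Lemma F2_oppr (V : lmodType 'F_2) (v : V) : - v = v.
Proof. by apply/esym/eqP; rewrite -addr_eq0 F2_addrr. Qed.

(** The only scalars are 0 and 1, so a relation among distinct nonzero vectors must involve all
    three with coefficient 1. *)
Lemma free3_F2 (V : vectType 'F_2) (u v w : V) :
    u != 0 -> v != 0 -> w != 0 -> u != v -> u != w -> v != w ->
  free [:: u; v; w] = (u + v + w != 0).
Proof.
move=> u0 v0 w0 uv uw vw.
have sum0 : (u + v + w == 0) = (u == v + w).
  by rewrite -addrA addr_eq0 F2_oppr.
rewrite !free_cons !span_cons span_nil addv0 nil_free andbT memv0 w0 andbT.
have -> : v \notin <[w]>%VS.
  apply/negP => /vlineP[a va]; have [a0|a1] := F2P a.
    by rewrite va a0 scale0r eqxx in v0.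
  by rewrite va a1 scale1r eqxx in vw.
rewrite andbT sum0; congr negb; apply/idP/eqP => [|->].
  move=> /memv_addP[_ /vlineP[a ->] [_ /vlineP[b ->] uE]].
  move: uE u0 uv uw; have [->|->] := F2P a; have [->|->] := F2P b => ->;
    by rewrite ?scale0r ?scale1r ?add0r ?addr0 ?eqxx.
by apply: memv_add; exact: memv_line.
Qed.

Section SymplecticGraph.
Variable n : nat.

Definition plane : Type := ('rV['F_2]_n * 'rV['F_2]_n)%type.
HB.instance Definition _ := Finite.on plane.
HB.instance Definition _ := GRing.Lmodule.on plane.

Definition dot (a b : 'rV['F_2]_n) : 'F_2 := \sum_i a 0 i * b 0 i.

Definition symplectic (x y : plane) : 'F_2 := dot x.1 y.2 + dot y.1 x.2.

(* The graph of the quadratic form [1 + a . b], whose polarization is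
   [symplectic]. *)
Definition quadric (x : plane) : 'rV['F_2]_(n + (n + 1)) :=
  row_mx x.1 (row_mx x.2 (1 + dot x.1 x.2)%:M).

Lemma dotDl a b c : dot (a + b) c = dot a c + dot b c.
Proof. by rewrite -big_split; apply: eq_bigr => i _; rewrite mxE mulrDl. Qed.

Lemma dotC a b : dot a b = dot b a.
Proof. by apply: eq_bigr => i _; rewrite mulrC. Qed.

Lemma dotDr a b c : dot a (b + c) = dot a b + dot a c.
Proof. by rewrite dotC dotDl !(dotC a). Qed.

Lemma dot_delta a i : dot a (delta_mx 0 i) = a 0 i.
Proof.
rewrite /dot (bigD1 i)//= mxE !eqxx mulr1 big1 ?addr0// => j ji.
by rewrite mxE (negbTE ji) andbF mulr0.
Qed.

Lemma dot0r a : dot a 0 = 0.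
Proof. by rewrite /dot big1// => i _; rewrite mxE mulr0. Qed.

Lemma symplecticDl x y z :
  symplectic (x + y) z = symplectic x z + symplectic y z.
Proof. by rewrite /symplectic dotDl dotDr addrACA. Qed.

Lemma symplecticC x y : symplectic x y = symplectic y x.
Proof. by rewrite /symplectic addrC. Qed.

Lemma symplecticDr x y z :
  symplectic x (y + z) = symplectic x y + symplectic x z.
Proof. by rewrite symplecticC symplecticDl !(symplecticC x). Qed.

Lemma symplectic0l x : symplectic 0 x = 0.
Proof. by rewrite /symplectic dotC !dot0r addr0. Qed.

Lemma symplecticxx x : symplectic x x = 0.
Proof. exact: F2_double. Qed.

Lemma symplectic_nondegenerate x :
  x != 0 -> exists y, symplectic x y == 1.
Proof.
have nz (a : 'rV['F_2]_n) : a != 0 -> exists i, a 0 i = 1.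
  move=> /rV0Pn[i ai]; exists i; have [a0|//] := F2P (a 0 i).
  by rewrite a0 eqxx in ai.
case: x => a b; rewrite xpair_eqE negb_and => /orP[] /nz [i e1].
  by exists (0, delta_mx 0 i); rewrite /symplectic/= dot_delta dotC dot0r addr0 e1.
by exists (delta_mx 0 i, 0); rewrite /symplectic/= dot0r dotC dot_delta add0r e1.
Qed.

Lemma quadric_inj : injective quadric.
Proof.
by move=> [a b] [a' b'] /eq_row_mx[/= -> /eq_row_mx[-> _]].
Qed.

(** If the first two blocks vanish, the last coordinate is the constant 1. *)
Lemma quadric_neq0 x : quadric x != 0.
Proof.
apply/eqP; rewrite /quadric -row_mx0 => /eq_row_mx[a0].
rewrite -[RHS]row_mx0 => /eq_row_mx[_]; rewrite a0 dotC dot0r addr0.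
by move/matrixP => /(_ 0 0); rewrite !mxE.
Qed.

(** For [z = x + y] the dot products in the last coordinate add up to [symplectic x y] by
    polarization, and the three constants to 1; the coordinate vanishes exactly when the form equals
    1. *)
Lemma quadric_sum_eq0 x y z :
  (quadric x + quadric y + quadric z == 0) =
  (z == x + y) && (symplectic x y == 1).
Proof.
have zE : (z == x + y) = (x + y + z == 0).
  by rewrite [x + y + z]addrC addr_eq0 F2_oppr.
have -> : quadric x + quadric y + quadric z = row_mx (x + y + z).1
    (row_mx (x + y + z).2
       (1 + (dot x.1 x.2 + dot y.1 y.2 + dot z.1 z.2))%:M).
  rewrite /quadric !add_row_mx -!raddfD/=; congr (row_mx _ (row_mx _ _%:M)).
  (* [ring] does not use characteristic 2, so the vanishing summand [1 + 1] is split off by hand. *)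
  rewrite [LHS](_ : _ = (1 + 1) + (1 + (dot x.1 x.2 + dot y.1 y.2 + dot z.1 z.2))).
    by rewrite F2_double add0r.
  by ring.
rewrite !row_mx_eq0 andbA.
have -> : ((x + y + z).1 == 0) && ((x + y + z).2 == 0) = (z == x + y).
  by rewrite zE; case: (x + y + z).
case: eqP => //= ->.
rewrite dotDl !dotDr.
have -> : dot x.1 x.2 + dot y.1 y.2 + (dot x.1 x.2 + dot x.1 y.2 +
     (dot y.1 x.2 + dot y.1 y.2)) = (dot x.1 x.2 + dot x.1 x.2) +
     (dot y.1 y.2 + dot y.1 y.2) + symplectic x y.
  by rewrite /symplectic; ring.
rewrite !F2_double !add0r.
have [->|->] := F2P (symplectic x y); rewrite ?addr0.
  by rewrite (negbTE (matrix_nonzero1 _ _)).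
by rewrite F2_double raddf0 !eqxx.
Qed.

(** Quadric points are nonzero and distinct, so a third point can only be [x + y]. When the form is
    1, [x] and [y] are nonzero and distinct, which makes [x + y] differ from both. *)
Lemma third_point_quadric (x y : plane) :
  third_point (fin_mstruct (vector_indep quadric)) x y <-> symplectic x y = 1.
Proof.
have indep3 z : x != y -> z != x -> z != y ->
    fin_mstruct (vector_indep quadric) 2 (fun l : 'I_3 => nth z [:: x; y; z] l)
    <-> ~~ ((z == x + y) && (symplectic x y == 1)).
  move=> xy zx zy.
  set p := fun l : 'I_3 => _.
  have p_inj : injective p.
    move=> [[|[|[|i]]] hi] [[|[|[|j]]] hj] //= pij; apply: val_inj => //=;
    by move: pij xy zx zy; rewrite /p /= => ->; rewrite eqxx.
  have -> : fin_mstruct (vector_indep quadric) 2 p =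
      vector_indep quadric [set p i | i : 'I_3].
    by apply/propext; split=> [[]|].
  rewrite /vector_indep (@perm_free _ _ _ [:: quadric x; quadric y; quadric z]).
    rewrite free3_F2 ?quadric_neq0 ?(inj_eq quadric_inj)// ?[_ == z]eq_sym//.
    by rewrite quadric_sum_eq0.
  rewrite -[[:: quadric x; _; _]]/(map quadric [:: x; y; z]).
  apply/perm_map/uniq_perm; first exact: enum_uniq.
    by rewrite /= !inE negb_or xy eq_sym zx eq_sym zy.
  move=> t; rewrite mem_enum !inE; apply/imsetP/idP => [[i _ ->]|].
    by case: i => [[|[|[|i]]] hi] //=; rewrite /p /= eqxx ?orbT.
  by move=> /or3P[] /eqP->; [exists (@Ordinal 3 0 isT)|
    exists (@Ordinal 3 1 isT)|exists (@Ordinal 3 2 isT)].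
split=> [[/eqP xy [z [nI [/eqP zx /eqP zy]]]]|s1].
  by apply/eqP; apply: contrapT => /negP s1; apply/nI/indep3 => //;
    rewrite (negbTE s1) andbF.
have x0 : x != 0 by apply: contra_eq_neq s1 => ->; rewrite symplectic0l.
have y0 : y != 0 by apply: contra_eq_neq s1 => ->; rewrite symplecticC symplectic0l.
have xy : x != y by apply: contra_eq_neq s1 => ->; rewrite symplecticxx.
split; first exact/eqP.
have zx : x + y != x by rewrite -subr_eq0 addrC addKr.
have zy : x + y != y by rewrite -subr_eq0 addrK.
exists (x + y); split; last by split; apply/eqP.
by move=> /indep3 => /(_ xy zx zy); rewrite eqxx s1 eqxx.
Qed.

Lemma card_plane : #|{: plane}| = (4 ^ n)%N.
Proof. by rewrite card_prod !card_mx card_Fp// mul1n -expnMn. Qed.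

End SymplecticGraph.

(** * Counting odd 4-cycles *)

Section CycleCount.
Variable n : nat.
Local Notation i0 := (@Ordinal 4 0 isT).
Local Notation i1 := (@Ordinal 4 1 isT).
Local Notation i2 := (@Ordinal 4 2 isT).
Local Notation i3 := (@Ordinal 4 3 isT).

Definition odd_cycles : {set 4.-tuple (plane n)} :=
  finset (fun x : 4.-tuple (plane n) =>
    symplectic (tnth x i0 + tnth x i1) (tnth x i2 + tnth x i3) == 1).

Definition degenerate_cycles : {set 4.-tuple (plane n)} :=
  finset (fun x : 4.-tuple (plane n) => tnth x i0 == tnth x i1).

Lemma plane_addr_eq0 (x y : plane n) : (x + y == 0) = (x == y).
Proof. by rewrite addr_eq0 F2_oppr. Qed.

Lemma symplectic_cycle (a b c e : plane n) :
  (symplectic (a + b) (c + e) == 1) =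
  ((symplectic a c == 1) (+) (symplectic b c == 1)) (+)
  ((symplectic a e == 1) (+) (symplectic b e == 1)).
Proof.
rewrite symplecticDr !symplecticDl.
move: (symplectic a c) (symplectic b c) (symplectic a e) (symplectic b e).
by move=> p q r t; rewrite !F2_addb.
Qed.

(* Moving the last vertex by some [w] with [symplectic (x0 + x1) w = 1] flips
   the parity of a nondegenerate cycle. *)
Lemma card_odd_cycles :
  (#|odd_cycles| * 2 + #|degenerate_cycles| = #|{: plane n}| ^ 4)%N.
Proof.
have /choice[w wP] (u : plane n) : exists w, u != 0 -> symplectic u w == 1.
  have [->|/symplectic_nondegenerate[w uw]] := eqVneq u 0; first by exists 0.
  by exists w.
pose flip (x : 4.-tuple (plane n)) : 4.-tuple (plane n) :=
  [tuple tnth x i0; tnth x i1; tnth x i2;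
    tnth x i3 + w (tnth x i0 + tnth x i1)].
have flipK : involutive flip.
  move=> x; apply: eq_from_tnth => -[[|[|[|[|i]]]] hi] //=;
    rewrite /flip !(tnth_nth 0)//= -addrA F2_addrr addr0.
  by [].
(* [flip] therefore matches the odd cycles with the tuples that are neither odd nor degenerate, and
   these two classes have equal size. *)
have flipE x : (flip x \in odd_cycles) =
    (x \notin odd_cycles :|: degenerate_cycles).
  rewrite !inE /flip !(tnth_nth 0) /=.
  set a := nth 0 x 0; set b := nth 0 x 1; set c := nth 0 x 2; set e := nth 0 x 3.
  rewrite addrA [symplectic _ (_ + w _)]symplecticDr [LHS]F2_addb.
  have [ab|ab] := boolP (a == b).
    have /eqP-> : a + b == 0 by rewrite plane_addr_eq0.
    by rewrite !symplectic0l.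
  by rewrite orbF wP ?plane_addr_eq0// addbT.
have disj : odd_cycles :&: degenerate_cycles = finset.set0.
  apply/setP => x; rewrite !inE; apply/negP => /andP[+ x01].
  have /eqP-> : tnth x i0 + tnth x i1 == 0 by rewrite plane_addr_eq0.
  by rewrite symplectic0l.
have cardU : #|odd_cycles :|: degenerate_cycles| =
    (#|odd_cycles| + #|degenerate_cycles|)%N.
  by rewrite cardsU disj cards0 subn0.
have cardC : #|~: (odd_cycles :|: degenerate_cycles)| = #|odd_cycles|.
  rewrite -[RHS](on_card_preimset (f := flip)); last first.
    exact/onW_bij/inv_bij.
  by apply: eq_card => x; rewrite finset.in_setC -flipE !inE.
rewrite -card_tuple -(cardsC (odd_cycles :|: degenerate_cycles)) cardU cardC.
by rewrite muln2 -addnn addnAC.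
Qed.

(** A degenerate tuple is determined by its last three entries. *)
Lemma card_degenerate_cycles : (#|degenerate_cycles| <= #|{: plane n}| ^ 3)%N.
Proof.
rewrite -card_tuple -(card_in_imset (f := fun x : 4.-tuple (plane n) =>
   [tuple of behead x])).
  exact: max_card.
move=> x y; rewrite !inE => /eqP x01 /eqP y01 /(congr1 val) /= xy.
apply: val_inj.
move: x y x01 y01 xy => [[|x0 [|x1 x]]//= hx] [[|y0 [|y1 y]]//= hy].
by rewrite !(tnth_nth 0)/= => -> -> [-> ->].
Qed.

(** With N points and D degenerate tuples the defect from 1/2 is D / (2 N^4), at most 1 / (2 N)
    since D <= N^3, and N = 4^n exceeds n. *)
Lemma stone_cycle_formula (R : realType) :
  `|1 / 2 - stone_fin R (fin_mstruct (vector_indep (@quadric n))) 4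
      cycle_formula| <= (n.+1%:R)^-1.
Proof.
have -> : stone_fin R (fin_mstruct (vector_indep (@quadric n))) 4 cycle_formula
   = #|odd_cycles|%:R / (#|{: plane n}| ^ 4)%:R.
  congr (_%:R / _); rewrite dset_cycle; apply: eq_card => x.
  rewrite [LHS]finset.inE [RHS]finset.inE.
  have S (i j : 'I_4) : `[< dset (fin_mstruct (vector_indep (@quadric n))) 2
       (third_point_formula 0 1) (pair_proj i j x) >] =
       (symplectic (tnth x i) (tnth x j) == 1).
    by apply/asboolP/eqP => /[dup] _; rewrite dset_third_point third_point_quadric.
  rewrite symplectic_cycle; transitivity (cycle_parity (dset (fin_mstruct
      (vector_indep (@quadric n))) 2 (third_point_formula 0 1)) x).
    by rewrite /= !asboolb.
  by rewrite /cycle_parity /= !S.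
set N := #|{: plane n}|.
have N0 : (0 < N)%N by rewrite /N card_plane expn_gt0.
have nN : (n < N)%N by rewrite /N card_plane ltn_expl.
have NR0 : 0 < N%:R :> R by rewrite ltr0n.
have := card_odd_cycles; have := card_degenerate_cycles; rewrite -/N.
set D := #|degenerate_cycles|; set O := #|odd_cycles| => D3 OD.
have -> : 1 / 2 - O%:R / (N ^ 4)%:R = D%:R / (2 * N%:R ^+ 4) :> R.
  have -> : O%:R = (N%:R ^+ 4 - D%:R) / 2 :> R.
    by rewrite -natrX -OD natrD natrM; field.
  by rewrite natrX; field; rewrite gt_eqF.
have ND : D%:R / (2 * N%:R ^+ 4) <= N%:R^-1 :> R.
  rewrite ler_pdivrMr ?mulr_gt0 ?exprn_gt0//.
  have -> : N%:R^-1 * (2 * N%:R ^+ 4) = 2 * N%:R ^+ 3 :> R.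
    by field; rewrite gt_eqF.
  apply: (@le_trans _ _ (N ^ 3)%:R); first by rewrite ler_nat.
  have : 0 <= N%:R ^+ 3 :> R by rewrite exprn_ge0// ltW.
  by rewrite natrX; lra.
rewrite ger0_norm; last by rewrite divr_ge0// mulr_ge0// exprn_ge0// ltW.
apply: (le_trans ND); rewrite lef_pV2 ?posrE ?ltr0n//.
by rewrite ler_nat.
Qed.

End CycleCount.

Theorem theorem5p2 (R : realType) :
  exists (E : nat -> finType) (indep : forall n, {set E n} -> bool),
    [/\ (forall n, (0 < #|E n|)%N),
        (forall n, fin_matroid (indep n)),
        (forall n, binary (indep n)),
        FO_convergent R E indep &
        ~ has_limit_matroid_modeling R E indep].
Proof.
have [s ns conv] := FO_convergent_subsequence R
  (fun n => vector_indep (@quadric n)).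
exists (fun n => plane (s n) : finType), (fun n => vector_indep (@quadric (s n))).
split=> [n|n|n||].
- by rewrite card_plane expn_gt0.
- exact: fin_matroid_vector.
- by exists (s n + (s n + 1))%N, (@quadric (s n)).
- exact: conv.
apply: no_limit_matroid_modeling; apply/cvgrPdist_lt => e e0.
near=> n; apply: (le_lt_trans (stone_cycle_formula (s n) R)).
(* Since [n <= s n], the error bound of the full sequence passes to the subsequence. *)
apply: (@le_lt_trans _ _ n.+1%:R^-1).
  by rewrite lef_pV2 ?posrE ?ltr0n// ler_nat ltnS.
by near: n; exact: near_infty_natSinv_lt (PosNum e0).
Unshelve. all: by end_near. Qed.
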